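(* Let $b>0$. Let $f\in C(\mathbb{R})$ be strictly increasing with $f(0)=0$ and $f(s)\to\pm\infty$ as $s\to\pm\infty$. Let $g\in C(\mathbb{R})$ be positive and such that $|s|^{\alpha}g(s)\to C_\pm$ as $s\to\pm\infty$ for some exponent $\alpha>2$ and constants $C_\pm>0$. Then there exists a pair $(W,c)\in\{C([-b,b])\cap C^2((-b,b))\}\times(0,\infty)$ satisfying $$c=f(g(W_x)W_{xx})\ \text{ in } (-b,b),\qquad W_x(b)=\infty,\quad W_x(-b)=-\infty. \qquad (\ast)$$ Moreover, the following properties hold. (i) If $(\tilde W,\tilde c)\in\{C([-b,b])\cap C^{0,1}((-b,b))\}\times\mathbb{R}$ is another pair satisfying $(\ast)$ in the viscosity sense, then $\tilde c=c$ and there exists a constant $a\in\mathbb{R}$ such that $\tilde W=W+a$ in $[-b,b]$. (ii) The profile function $W$ is strictly convex and of class $C^{\frac{\alpha-2}{\alpha-1}}([-b,b])$ (Hölder continuous on $[-b,b]$ with exponent $\frac{\alpha-2}{\alpha-1}$).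
   Context: For $W\in C^2((-b,b))$, the boundary condition $W_x(\pm b)=\pm\infty$ means $W_x(x)\to\pm\infty$ as $x\to\pm b$, and the equation holds pointwise (classical sense). $C^{0,1}((-b,b))$ denotes functions that are Lipschitz on each compact subinterval of $(-b,b)$. Viscosity sense for the stationary problem $(\ast)$ with a given $c\in\mathbb{R}$. Subsolution: an upper semicontinuous function $W$ on $[-b,b]$ such that whenever $\phi\in C^2([-b,b])$ and $W-\phi$ attains a local maximum at $x_0\in(-b,b)$, one has $c-f\big(g(\phi_x(x_0))\phi_{xx}(x_0)\big)\le0$. Supersolution: a lower semicontinuous function $W$ on $[-b,b]$ such that (i) whenever $\phi\in C^2([-b,b])$ and $W-\phi$ attains a local minimum at $x_0\in(-b,b)$, one has $c-f\big(g(\phi_x(x_0))\phi_{xx}(x_0)\big)\ge0$; and (ii) for every $\phi\in C^2([-b,b])$, $W-\phi$ never attains a local minimum (relative to $[-b,b]$) at $x=b$ or $x=-b$. Solution: a function in $C([-b,b])$ that is both a subsolution and a supersolution. *)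

(* Defs.v *)
From mathcomp Require Export all_boot all_order ssralg ssrnum ssrint interval.
From mathcomp Require Export all_classical all_reals all_analysis.

Set Implicit Arguments.
Unset Strict Implicit.
Unset Printing Implicit Defensive.

Export Order.TTheory GRing.Theory Num.Theory.
Export numFieldNormedType.Exports.

Local Open Scope classical_set_scope.
Local Open Scope ring_scope.

Definition C2_oo {R : realType} (u v : R) (phi : R -> R) : Prop :=
  [/\ {in `]u, v[, forall x, derivable phi x 1},
      {in `]u, v[, forall x, derivable phi^`() x 1} &
      {within `]u, v[, continuous phi^`(2)}].

(* The derivatives are the two-sided ones on the open interval: the values of
   [phi] outside `[u, v] are irrelevant. *)
Definition C2_cc {R : realType} (u v : R) (phi : R -> R) : Prop :=
  [/\ C2_oo u v phi,
      {within `[u, v], continuous phi},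
      exists2 d1 : R -> R, {within `[u, v], continuous d1} &
        {in `]u, v[, phi^`() =1 d1} &
      exists2 d2 : R -> R, {within `[u, v], continuous d2} &
        {in `]u, v[, phi^`(2) =1 d2}].

Definition loc_lipschitz_oo {R : realType} (u v : R) (W : R -> R) : Prop :=
  forall x y : R, u < x -> y < v -> [lipschitz W z | z in `[x, y]%classic].

Definition hoelder_cc {R : realType} (gamma u v : R) (W : R -> R) : Prop :=
  exists K : R, {in `[u, v] &, forall x y : R,
    `|W x - W y| <= K * `|x - y| `^ gamma}.

Definition strictly_convex_cc {R : realType} (u v : R) (W : R -> R) : Prop :=
  {in `[u, v] &, forall x y : R, x != y -> forall t : R, 0 < t < 1 ->
    W (t * x + (1 - t) * y) < t * W x + (1 - t) * W y}.

(* Semicontinuity on `[u, v] is for the induced topology; points of the type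
   [subspace A] that lie outside [A] are isolated. *)
Definition lsc_cc {R : realType} (u v : R) (W : R -> R) : Prop :=
  lower_semicontinuous (EFin \o W : subspace `[u, v]%classic -> \bar R).

Definition usc_cc {R : realType} (u v : R) (W : R -> R) : Prop :=
  lsc_cc u v (fun x => - W x).

Definition local_min_within {R : realType} (A : set R) (h : R -> R) (x0 : R)
    : Prop :=
  A x0 /\ \forall x \near within A (nbhs x0), h x0 <= h x.

Definition local_max_within {R : realType} (A : set R) (h : R -> R) (x0 : R)
    : Prop :=
  A x0 /\ \forall x \near within A (nbhs x0), h x <= h x0.

Section StationaryProblem.
Context {R : realType}.
Implicit Types (b c : R) (f g W : R -> R).

Definition classical_solution b f g W c : Prop :=
  [/\ {within `[- b, b], continuous W},
      C2_oo (- b) b W,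
      {in `]- b, b[, forall x, c = f (g (W^`() x) * W^`(2) x)},
      W^`() x @[x --> b^'-] --> +oo &
      W^`() x @[x --> (- b)^'+] --> -oo].

Definition viscosity_subsolution b f g W c : Prop :=
  usc_cc (- b) b W /\
  forall phi : R -> R, C2_cc (- b) b phi ->
    forall x0 : R, x0 \in `]- b, b[ ->
      local_max_within `[- b, b]%classic (fun x => W x - phi x) x0 ->
      c - f (g (phi^`() x0) * phi^`(2) x0) <= 0.

Definition viscosity_supersolution b f g W c : Prop :=
  [/\ lsc_cc (- b) b W,
      forall phi : R -> R, C2_cc (- b) b phi ->
        forall x0 : R, x0 \in `]- b, b[ ->
          local_min_within `[- b, b]%classic (fun x => W x - phi x) x0 ->
          c - f (g (phi^`() x0) * phi^`(2) x0) >= 0 &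
      forall phi : R -> R, C2_cc (- b) b phi ->
        ~ local_min_within `[- b, b]%classic (fun x => W x - phi x) b /\
        ~ local_min_within `[- b, b]%classic (fun x => W x - phi x) (- b)].

Definition viscosity_solution b f g W c : Prop :=
  [/\ {within `[- b, b], continuous W},
      viscosity_subsolution b f g W c &
      viscosity_supersolution b f g W c].

End StationaryProblem.

(* Main.v *)
Require Import Defs.
From mathcomp Require Import ring lra.

(** Write [c = f k]; as [f] is an increasing bijection, the equation reads
    [g (W') * W'' = k], that is [(G (W'))' = k] for a primitive [G] of [g].
    Since [alpha > 2 > 1], [G] is bounded, with limits [A < B] at infinity, so a
    solution with slopes [-oo] and [+oo] at [- b] and [b] must have
    [k = (B - A) / (2 * b)] and [W' = G^-1 (k * x + d)], with [d] the midpoint of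
    [A] and [B]. Writing [Z] for a primitive of [p = G^-1], we get
    [W x = Z (k * x + d) / k]. Moreover [Z = H \o p], where [H' = s * g s], and
    since [alpha > 2] the function [H] is bounded too; hence [Z] extends to
    [[A, B]]. Cutting the integral of [s * g s] at the height [L] and optimising
    over [L] bounds increments of [H] by the power [(alpha - 2) / (alpha - 1)] of
    those of [G]: this is the Hoelder regularity of [W]
    ([profile_exists], [momentum_hoelder]). Strict convexity holds because [p] is
    increasing.

    Uniqueness compares a viscosity solution [V] of speed [f k'] with the family
    [phi x = Z (kappa * x + e) / kappa], which satisfies
    [g (phi') * phi'' = kappa] exactly. Thus [V] cannot be touched from below by
    [phi] when [kappa > k'], nor from above in the interior when [kappa < k'];
    and at the endpoints it can never be touched from below by a smooth
    function. Choosing [kappa] between [k] and [k'] gives [k <= k']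
    ([speed_ge]) and [k' <= k] ([speed_le]); the latter uses that [V] is Lipschitz
    inside, so that it cannot follow a [phi] whose slope blows up there.

    When [k' = k], perturbing [kappa] around [k] shows that [V - phi] has no
    strict interior extremum on any subinterval, for every shift [e]
    ([no_interior_min], [no_interior_max]). If [e] is slightly above [d], then
    [phi] is smooth at [- b], where [V - phi] has no local minimum; so [V - phi]
    is nonincreasing. If [e] is slightly below [d], the same argument at [b]
    makes it nondecreasing. Letting [e] tend to [d], [V - W] is constant
    ([diff_constant]). *)

Set Implicit Arguments.
Unset Strict Implicit.

Local Open Scope classical_set_scope.
Local Open Scope ring_scope.

(** * Calculus on the real line *)

Section calculus.
Context {R : realType}.
Implicit Types (F dF h f : R -> R) (x y z r m l u v gamma : R).

Lemma is_derive_continuous F x l : is_derive x 1 F l -> {for x, continuous F}.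
Proof.
by move=> [dF _]; exact/differentiable_continuous/derivable1_diffP.
Qed.

Lemma is_derive_derive1 F x l : is_derive x 1 F l -> F^`() x = l.
Proof. by move=> dF; rewrite derive1E derive_val. Qed.

Lemma mean_value F dF x y : x < y ->
  (forall z, x <= z <= y -> is_derive z 1 F (dF z)) ->
  exists2 c, x < c < y & F y - F x = dF c * (y - x).
Proof.
move=> xy dFE; have [z|z|c] := @MVT R F dF x y xy; last first.
- by rewrite in_itv /= => ? ?; exists c.
- move: z; apply/continuous_in_subspaceT => z; rewrite inE /= in_itv /= => /dFE.
  exact: is_derive_continuous.
- by rewrite in_itv /= => /andP[xz zy]; apply: dFE; rewrite !ltW.
Qed.

Lemma nondecreasing_of_derive F dF x y : x <= y ->
  (forall z, x <= z <= y -> is_derive z 1 F (dF z)) ->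
  (forall z, x <= z <= y -> 0 <= dF z) -> F x <= F y.
Proof.
rewrite le_eqVlt => /predU1P[->//|xy] dFE dF0.
have [c /andP[xc cy] E] := mean_value xy dFE.
rewrite -subr_ge0 E; apply: mulr_ge0; last by rewrite subr_ge0 ltW.
by apply: dF0; rewrite !ltW.
Qed.

Lemma increasing_of_derive F dF x y : x < y ->
  (forall z, x <= z <= y -> is_derive z 1 F (dF z)) ->
  (forall z, x <= z <= y -> 0 < dF z) -> F x < F y.
Proof.
move=> xy dFE dF0; have [c /andP[xc cy] E] := mean_value xy dFE.
by rewrite -subr_gt0 E mulr_gt0 ?subr_gt0// dF0// !ltW.
Qed.

(** The integral of [h] over [[a, x]] is a primitive only to the right of [a].
    The base point [- `|x| - 1] moves with [x]; normalising at [0] makes the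
    value independent of it, so near any point it may be taken constant. *)
Lemma primitive_exists h : continuous h ->
  exists F, forall x, is_derive x 1 F (h x).
Proof.
move=> ch.
pose I a x := (\int[@lebesgue_measure R]_(t in `[a, x]) h t)%R.
have dI a x : a < x -> is_derive x 1 (I a) (h x).
  move=> ax.
  have [] := @continuous_FTC1_closed R h a x (x + 1) _ _ ax (ch x).
  - by rewrite ltrDl.
  - apply: continuous_compact_integrable; first exact: segment_compact.
    exact: continuous_subspaceT.
  by move=> dI <-; rewrite derive1E; exact: derivableP.
have I_indep a a' x y : a < x -> a' < x -> x <= y ->
    I a y - I a x = I a' y - I a' x.
  move=> ax a'x; rewrite le_eqVlt => /predU1P[->|xy]; first by rewrite !subrr.
  have dD z : x <= z <= y -> is_derive z 1 (I a \- I a') ((fun=> 0) z).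
    move=> /andP[xz _].
    have d1 := dI a z (lt_le_trans ax xz); have d2 := dI a' z (lt_le_trans a'x xz).
    by apply: is_derive_eq; rewrite subrr.
  have [c _ /=] := mean_value xy dD; rewrite mul0r; lra.
pose J a x := I a x - I a 0.
have J_indep a a' x : a < 0 -> a' < 0 -> a < x -> a' < x -> J a x = J a' x.
  move=> a0 a'0 ax a'x; rewrite /J; have [x0|/ltW x0] := leP 0 x.
    exact: I_indep.
  have := I_indep _ _ _ _ ax a'x x0; lra.
exists (fun x => J (- `|x| - 1) x) => x.
pose n := - `|x| - 2.
have nx : n < x.
  by rewrite /n; have := ler_norm (- x); rewrite normrN; have := normr_ge0 x; lra.
have dJ : is_derive x 1 (J n) (h x).
  have d1 := dI n x nx; rewrite /J.
  by apply: is_derive_eq; rewrite subr0.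
apply: near_eq_is_derive dJ.
near=> y.
have yx : `|x - y| < 1 by near: y; apply: nbhsx_ballx.
rewrite /n; apply: J_indep; have := normr_ge0 x; have := normr_ge0 y;
  have := ler_norm (- y); rewrite normrN;
  have := ler_normD (y - x) x; rewrite subrK (distrC y); lra.
Unshelve. all: by end_near. Qed.

(** The second-order expansion, as a one-sided bound: a slightly smaller
    quadratic coefficient absorbs the Peano remainder. *)
Lemma taylor2_lower F dF x r m : (\forall y \near x, is_derive (y : R) 1 F (dF y)) ->
  is_derive x 1 dF m -> 2 * r < m ->
  \forall y \near x, F x + dF x * (y - x) + r * (y - x) ^+ 2 <= F y.
Proof.
move=> nF ddF rm.
have : h^-1 *: (dF (h + x) - dF x) @[h --> 0^'] --> m.
  have [] := ddF; rewrite /derivable /derive => /cvg_ex[l].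
  under eq_fun do rewrite /= [_%:A]mulr1.
  by move=> H; rewrite (cvg_lim _ H)// => <-.
move=> /cvgr_gt /(_ _ rm) /nbhs_ballP[e /= e0 He].
have /nbhs_ballP[e' /= e'0 He'] := nF.
near=> y.
have ye : `|x - y| < e by near: y; apply: nbhsx_ballx.
have ye' : `|x - y| < e' by near: y; apply: nbhsx_ballx.
(* The remainder [P] has a derivative of the sign of [y - x], so it is minimal
   at [x]. *)
pose P z := F z - dF x * (z - x) - r * (z - x) ^+ 2.
pose dP z := dF z - dF x - 2 * r * (z - x).
have dPE z : `|x - z| < e' -> is_derive z 1 P (dP z).
  move=> ze; have d1 : is_derive z 1 F (dF z) by apply: He'.
  rewrite /P; apply: is_derive_eq.
  by rewrite /dP /GRing.scale /=; ring.
have slope z : `|x - z| < e -> z != x -> 2 * r < (dF z - dF x) / (z - x).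
  move=> ze zx.
  have b0 : ball (0 : R) e (z - x) by rewrite /ball /= sub0r normrN distrC.
  by have := He _ b0; rewrite /= subr_eq0 subrK /GRing.scale /= [ltRHS]mulrC => /(_ zx).
suff : P x <= P y by rewrite /P !subrr expr0n /= !mulr0 !subr0; lra.
have [xy|yx|->//] := ltgtP x y.
- have dist z : x <= z <= y -> `|x - z| <= `|x - y|.
    by move=> /andP[xz zy]; rewrite distrC (distrC x) !ger0_norm; lra.
  apply: (@nondecreasing_of_derive P dP) => [||z xzy]; first exact: ltW.
    by move=> z /dist xzy; apply/dPE/(le_lt_trans xzy).
  rewrite /dP subr_ge0; have [->|zx] := eqVneq z x; first by rewrite !subrr mulr0.
  rewrite -ler_pdivlMr; last by move: zx xzy; rewrite neq_lt; lra.
  by apply/ltW/slope => //; apply: le_lt_trans ye; apply: dist.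
- have dist z : y <= z <= x -> `|x - z| <= `|x - y|.
    by move=> /andP[xz zy]; rewrite !ger0_norm; lra.
  rewrite -lerN2.
  apply: (@nondecreasing_of_derive (\- P) (\- dP)) => [||z xzy]; first exact: ltW.
    move=> z /dist xzy; have dz := dPE _ (le_lt_trans xzy ye').
    exact: is_derive_eq.
  rewrite /= oppr_ge0 /dP subr_le0.
  have [->|zx] := eqVneq z x; first by rewrite !subrr mulr0.
  have zx' : z - x < 0 by move: zx xzy; rewrite neq_lt; lra.
  rewrite -ler_ndivlMr //.
  by apply/ltW/slope => //; apply: le_lt_trans ye; apply: dist.
Unshelve. all: by end_near. Qed.

Lemma taylor2_upper F dF x r m : (\forall y \near x, is_derive (y : R) 1 F (dF y)) ->
  is_derive x 1 dF m -> m < 2 * r ->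
  \forall y \near x, F y <= F x + dF x * (y - x) + r * (y - x) ^+ 2.
Proof.
move=> nF ddF mr.
have nFN : \forall y \near x, is_derive (y : R) 1 (\- F) ((\- dF) y).
  by apply: filterS nF => y dy; exact: is_derive_eq.
have ddFN : is_derive x 1 (\- dF) (- m) by exact: is_derive_eq.
have mrN : 2 * - r < - m by lra.
by apply: filterS (taylor2_lower nFN ddFN mrN) => y /=; lra.
Qed.

Lemma continuous_unbounded_surj f : continuous f -> f s @[s --> +oo] --> +oo ->
  f s @[s --> -oo] --> -oo -> forall c, exists k, f k = c.
Proof.
move=> cf fp fn c.
have [N [_ HN]] : \forall s \near +oo, c <= f s by apply: cvgry_ge.
have [M [_ HM]] : \forall s \near -oo, f s <= c by apply: cvgrNy_le.
pose y := Num.max N M + 1; pose x := Num.min N M - 1.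
have cy : c <= f y.
  by apply: HN; rewrite /y (@le_lt_trans _ _ (Num.max N M)) ?le_max ?lexx ?ltrDl.
have xc : f x <= c.
  by apply: HM; rewrite /x (@lt_le_trans _ _ (Num.min N M)) ?ge_min ?lexx ?orbT ?gtrBl.
have xy : x <= y.
  have : Num.min N M <= Num.max N M by rewrite ge_min le_max lexx.
  by rewrite /x /y; lra.
have [|s _ <-] := IVT xy (continuous_subspaceT cf) (v := c); last by exists s.
by rewrite ge_min le_max xc cy orbT.
Qed.

Lemma strictly_convex_of_derive u v (W dW : R -> R) :
  {within `[u, v], continuous W} ->
  (forall x, u < x < v -> is_derive x 1 W (dW x)) ->
  (forall x y, u < x -> x < y -> y < v -> dW x < dW y) ->
  strictly_convex_cc u v W.
Proof.
move=> cW dWE dWinc.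
have core x y t : u <= x -> x < y -> y <= v -> 0 < t < 1 ->
    W (t * x + (1 - t) * y) < t * W x + (1 - t) * W y.
  move=> ux xy yv /andP[t0 t1]; set z := t * x + (1 - t) * y.
  have s0 : 0 < 1 - t by rewrite subr_gt0.
  have d0 : 0 < y - x by rewrite subr_gt0.
  have zx : z - x = (1 - t) * (y - x) by rewrite /z; ring.
  have yz : y - z = t * (y - x) by rewrite /z; ring.
  have xz' : x < z by rewrite -subr_gt0 zx mulr_gt0.
  have zy' : z < y by rewrite -subr_gt0 yz mulr_gt0.
  have mv x' y' : u <= x' -> x' < y' -> y' <= v ->
      exists2 w, x' < w < y' & W y' - W x' = dW w * (y' - x').
    move=> ux' xy' yv'.
    have [w||w] := @MVT R W dW x' y' xy'.
    - rewrite in_itv /= => /andP[xw wy]; apply: dWE.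
      by rewrite (le_lt_trans ux') // (lt_le_trans wy).
    - apply: continuous_subspaceW cW => w /=; rewrite !in_itv /= => /andP[xw wy].
      by rewrite (le_trans ux') // (le_trans wy).
    - by rewrite in_itv /=; exists w.
  have [w1 /andP[xw1 w1z] E1] := mv x z ux xz' (le_trans (ltW zy') yv).
  have [w2 /andP[zw2 w2y] E2] := mv z y (le_trans ux (ltW xz')) zy' yv.
  have dlt : dW w1 < dW w2.
    by apply: dWinc; [exact: le_lt_trans xw1|exact: lt_trans zw2|exact: lt_le_trans yv].
  rewrite zx in E1; rewrite yz in E2.
  have pos : 0 < t * (1 - t) * (y - x) * (dW w2 - dW w1) by rewrite !mulr_gt0 // subr_gt0.
  rewrite -subr_gt0; apply: (lt_le_trans pos); rewrite le_eqVlt; apply/orP; left.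
  apply/eqP; transitivity ((1 - t) * (W y - W z) - t * (W z - W x)); last by ring.
  by rewrite E1 E2; ring.
move=> x y; rewrite !in_itv /= => /andP[ux xv] /andP[uy yv] xy t t01.
move: xy; rewrite neq_lt => /orP[xy|yx]; first exact: core.
have s01 : 0 < 1 - t < 1 by move: t01 => /andP[? ?]; apply/andP; split; lra.
have := core y x (1 - t) uy yx xv s01.
by rewrite subKr (addrC ((1 - t) * y)) (addrC ((1 - t) * W y)).
Qed.

Lemma hoelder_continuous gamma u v (W : R -> R) : 0 < gamma ->
  hoelder_cc gamma u v W -> {within `[u, v], continuous W}.
Proof.
move=> gamma_gt0 [K HK]; apply/subspace_continuousP => x xuv.
apply/cvgrPdist_le => e e0.
have K1 : 0 < `|K| + 1 by rewrite ltr_wpDl.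
pose dl := (e / (`|K| + 1)) `^ gamma^-1.
have dl0 : 0 < dl by rewrite powR_gt0 // divr_gt0.
apply: filterS (nbhsx_ballx x dl dl0) => y xy yuv.
have xuv' : x \in `[u, v] := xuv.
have yuv' : y \in `[u, v] := yuv.
apply: (le_trans (HK x y xuv' yuv')).
apply: (@le_trans _ _ (`|K| * (e / (`|K| + 1)))).
  apply: (@le_trans _ _ (`|K| * `|x - y| `^ gamma)).
    by rewrite ler_wpM2r ?powR_ge0 // ler_norm.
  rewrite ler_wpM2l // (_ : e / (`|K| + 1) = dl `^ gamma); last first.
    by rewrite /dl -powRrM mulVf ?gt_eqF // powRr1 // divr_ge0 // ltW.
  by apply: ge0_ler_powR; rewrite ?nnegrE ?normr_ge0 // ltW.
rewrite mulrCA -[leRHS]mulr1 ler_wpM2l ?(ltW e0) // ler_pdivrMr //.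
by rewrite mul1r lerDl.
Qed.

End calculus.

Section affine_reparametrisation.
Context {R : realType}.
Implicit Types (k d x v A B : R).

Lemma is_derive_affine (F : R -> R) k d x l :
  is_derive (k * x + d) 1 F l -> is_derive x 1 (fun y => F (k * y + d)) (k * l).
Proof.
move=> dF; have da : is_derive x 1 (fun y => k * y + d) k.
  by apply: is_derive_eq; rewrite /GRing.scale /=; ring.
by rewrite [k * l]mulrC; exact: (@is_derive1_comp _ F (fun y => k * y + d)).
Qed.

Lemma near_affine_in A B k d x : A < k * x + d < B ->
  \forall y \near x, A < k * y + d < B.
Proof.
move=> xAB; have cont : k * y + d @[y --> x] --> k * x + d.
  by apply: cvgD; [apply: cvgM; [exact: cvg_cst|exact: cvg_id]|exact: cvg_cst].
have xin : k * x + d \in `]A, B[ by rewrite in_itv.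
have nxin : \forall y \near x, k * y + d \in `]A, B[ := cont _ (near_in_itvoo xin).
by apply: filterS nxin => y; rewrite in_itv.
Qed.

Lemma affine_at_left k d v (B : R) : 0 < k -> k * v + d = B ->
  k * x + d @[x --> v^'-] --> B^'-.
Proof.
move=> k0 <- P [e /= e0 He].
suff : \forall x \near v^'-, P (k * x + d) by [].
near=> x; apply: He.
  rewrite /ball_ /= (_ : k * v + d - (k * x + d) = k * (v - x)); last by ring.
  have xv : x < v by near: x; exact: nbhs_left_lt.
  rewrite gtr0_norm ?mulr_gt0 ?subr_gt0 // mulrC -ltr_pdivlMr //.
  rewrite ltrBlDl -ltrBlDr; near: x; apply: nbhs_left_gt.
  by rewrite gtrBl divr_gt0.
by rewrite ltrD2r ltr_pM2l //; near: x; exact: nbhs_left_lt.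
Unshelve. all: by end_near. Qed.

Lemma affine_at_right k d v (A : R) : 0 < k -> k * v + d = A ->
  k * x + d @[x --> v^'+] --> A^'+.
Proof.
move=> k0 <- P [e /= e0 He].
suff : \forall x \near v^'+, P (k * x + d) by [].
near=> x; apply: He.
  rewrite /ball_ /= distrC (_ : k * x + d - (k * v + d) = k * (x - v)); last by ring.
  have xv : v < x by near: x; exact: nbhs_right_gt.
  rewrite gtr0_norm ?mulr_gt0 ?subr_gt0 // mulrC -ltr_pdivlMr //.
  rewrite ltrBlDl; near: x; apply: nbhs_right_lt.
  by rewrite ltrDl divr_gt0.
by rewrite ltrD2r ltr_pM2l //; near: x; exact: nbhs_right_gt.
Unshelve. all: by end_near. Qed.

End affine_reparametrisation.

(** * Tails of the weight and of its first moment *)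

Section tails.
Context {R : realType}.
Implicit Types (g G H : R -> R) (s p q L K : R).

(** The limit gives the bound beyond some [N], compactness gives it on
    [[0, N]]; the resulting bound is valid down to [0], so that later cut-offs
    [L] may be arbitrarily small. *)
Lemma decay_bound g (alpha C : R) : continuous g -> (forall s, 0 < g s) ->
  0 <= alpha -> `|s| `^ alpha * g s @[s --> +oo] --> C ->
  exists2 K : R, 0 <= K & forall s, 0 < s -> s `^ alpha * g s <= K.
Proof.
move=> cg g0 al0 /cvgr_lt /(_ (C + 1)) H.
have {H} [N [_ HN]] : \forall s \near +oo, `|s| `^ alpha * g s < C + 1.
  by apply: H; rewrite ltrDl.
pose N' := `|N|.
have [m _ Hm] := @EVT_max R g 0 N' (normr_ge0 N) (continuous_subspaceT cg).
exists (N' `^ alpha * g m + `|C + 1|).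
  by rewrite addr_ge0// mulr_ge0 ?powR_ge0// ltW.
move=> s s0; have [Ns|sN] := ltP N' s.
  apply: (@le_trans _ _ (C + 1)).
    have := HN s (le_lt_trans (ler_norm N) Ns).
    by rewrite gtr0_norm// => /ltW.
  apply: (le_trans (ler_norm _)); rewrite lerDr mulr_ge0 ?powR_ge0//.
  exact: ltW.
apply: (@le_trans _ _ (N' `^ alpha * g m)); last by rewrite lerDl.
apply: ler_pM; rewrite ?powR_ge0//; first exact: ltW.
  by apply: ge0_ler_powR; rewrite // nnegrE ?normr_ge0 // ltW.
by apply: Hm; rewrite in_itv /= ltW.
Qed.

(** [s * g s <= K * s ^ (1 - alpha)], which has the primitive
    [- K / (alpha - 2) * s ^ (2 - alpha)], vanishing at infinity: here
    [2 < alpha] makes the first moment of [g] finite. *)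
Lemma tail_bound g H (alpha K : R) : 2 < alpha -> (forall s, 0 < g s) ->
  (forall s, is_derive s 1 H (s * g s)) ->
  (forall s, 0 < s -> s `^ alpha * g s <= K) ->
  forall L p q, 0 < L -> L <= p -> p <= q ->
    0 <= H q - H p <= K / (alpha - 2) * L `^ (2 - alpha).
Proof.
move=> al2 g0 dH gK.
have K0 : 0 <= K.
  by apply: le_trans (gK 1 ltr01); rewrite powR1 mul1r ltW.
have Hinc p q : 0 < p -> p <= q -> H p <= H q.
  move=> p0 pq; apply: (nondecreasing_of_derive pq (fun z _ => dH z)).
  by move=> z /andP[pz _]; rewrite mulr_ge0 ?ltW// (lt_le_trans p0).
move=> L p q L0 Lp pq; have p0 : 0 < p := lt_le_trans L0 Lp.
rewrite subr_ge0 Hinc //=.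
apply: (@le_trans _ _ (H q - H L)); first by rewrite lerD2l lerN2 Hinc.
have Lq := le_trans Lp pq.
pose F s := K / (alpha - 2) * - (s `^ (2 - alpha)) - H s.
suff : F L <= F q.
  rewrite /F; have : 0 <= K / (alpha - 2) * q `^ (2 - alpha).
    by rewrite mulr_ge0 ?powR_ge0// divr_ge0// subr_ge0 ltW.
  by rewrite !mulrN; lra.
pose dF s := K * s `^ (1 - alpha) - s * g s.
have dFE z : L <= z <= q -> is_derive z 1 F (dF z).
  move=> /andP[Lz _]; have z0 : 0 < z := lt_le_trans L0 Lz.
  have d1 := is_derive1_powR (2 - alpha) z0.
  rewrite /F; apply: is_derive_eq.
  rewrite /GRing.scale /= (_ : 2 - alpha - 1 = 1 - alpha); last by ring.
  by rewrite /dF; field; rewrite subr_eq0 gt_eqF.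
apply: (nondecreasing_of_derive Lq dFE) => z /andP[Lz _].
have z0 : 0 < z := lt_le_trans L0 Lz.
rewrite subr_ge0.
rewrite (_ : z * g z = (z `^ alpha * g z) * z `^ (1 - alpha)).
  by rewrite ler_wpM2r ?powR_ge0// gK.
rewrite mulrAC -powRD; last by rewrite (gt_eqF z0) implybT.
by rewrite addrC subrK powRr1// ltW.
Qed.


(** Where [`|s| <= L] the integrand [s * g s] of [H] is at most [L] times the
    integrand [g s] of [G]; the rest of the integral is a tail. *)
Lemma momentum_cut g G H (C e : R) : (forall s, 0 < g s) ->
  (forall s, is_derive s 1 G (g s)) -> (forall s, is_derive s 1 H (s * g s)) ->
  (forall L p q, 0 < L -> p <= q -> L <= p \/ q <= - L ->
    `|H q - H p| <= C * L `^ e) ->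
  forall L p q, 0 < L -> p <= q ->
    `|H q - H p| <= L * (G q - G p) + 2 * C * L `^ e.
Proof.
move=> g0 dG dH tail L p q L0 pq.
have Ginc s t : s <= t -> G s <= G t.
  move=> st; apply: (nondecreasing_of_derive st (fun z _ => dG z)) => z _.
  exact: ltW.
have T0 : 0 <= C * L `^ e.
  by apply: le_trans (tail L L L L0 (lexx _) _); [exact: normr_ge0|left].
have core s t : - L <= s -> s <= t -> t <= L -> `|H t - H s| <= L * (G t - G s).
  move=> Ls st tL; rewrite ler_norml; apply/andP; split.
    have dF z : s <= z <= t ->
        is_derive z 1 (fun y => L * G y + H y) (L * g z + z * g z).
      move=> _; have := dG z; have := dH z => d1 d2; exact: is_derive_eq.
    suff : L * G s + H s <= L * G t + H t by lra.
    apply: (nondecreasing_of_derive st dF) => z /andP[sz _].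
    by rewrite -mulrDl mulr_ge0 ?(ltW (g0 _))//; lra.
  have dF z : s <= z <= t ->
      is_derive z 1 (fun y => L * G y - H y) (L * g z - z * g z).
    move=> _; have := dG z; have := dH z => d1 d2; exact: is_derive_eq.
  suff : L * G s - H s <= L * G t - H t by lra.
  apply: (nondecreasing_of_derive st dF) => z /andP[_ zt].
  by rewrite -mulrBl mulr_ge0 ?(ltW (g0 _))//; lra.
have LG0 : 0 <= L * (G q - G p) by rewrite mulr_ge0 ?subr_ge0 ?Ginc// ltW.
have [Lp|pL] := leP L p; first by have := tail L p q L0 pq (or_introl Lp); lra.
have [qL|Lq] := leP q (- L); first by have := tail L p q L0 pq (or_intror qL); lra.
pose p' := Num.max p (- L); pose q' := Num.min q L.
have pp' : p <= p' by rewrite le_max lexx.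
have q'q : q' <= q by rewrite ge_min lexx.
have p'q' : p' <= q'.
  by rewrite ge_max !le_min pq (ltW pL) (ltW Lq) /=; lra.
have h1 : `|H q - H q'| <= C * L `^ e.
  rewrite /q'; case: (leP q L) => [_|Lq']; first by rewrite subrr normr0.
  by apply: tail => //; [exact: ltW|left].
have h2 : `|H p' - H p| <= C * L `^ e.
  rewrite /p'; case: (leP p (- L)) => [pL'|_]; last by rewrite subrr normr0.
  by apply: tail => //; right.
have h3 : `|H q' - H p'| <= L * (G q' - G p').
  by apply: core => //; rewrite ?le_max ?ge_min lexx orbT.
have h4 : L * (G q' - G p') <= L * (G q - G p).
  by rewrite ler_pM2l// lerB ?Ginc.
rewrite (_ : H q - H p = (H q - H q') + ((H q' - H p') + (H p' - H p))); last by ring.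
apply: (le_trans (ler_normD _ _)).
have := ler_normD (H q' - H p') (H p' - H p); lra.
Qed.

(** Optimising the cut-off [L]: the two terms of [momentum_cut] balance at
    [L = (G q - G p) ^ (- 1 / (alpha - 1))]. This is where the exponent
    [(alpha - 2) / (alpha - 1)] comes from. *)
Lemma momentum_hoelder g G H (C alpha : R) : (forall s, 0 < g s) -> 2 < alpha ->
  (forall s, is_derive s 1 G (g s)) -> (forall s, is_derive s 1 H (s * g s)) ->
  (forall L p q, 0 < L -> p <= q -> L <= p \/ q <= - L ->
    `|H q - H p| <= C * L `^ (2 - alpha)) ->
  forall p q, p <= q ->
    `|H q - H p| <= (1 + 2 * C) * (G q - G p) `^ ((alpha - 2) / (alpha - 1)).
Proof.
move=> g0 al2 dG dH tail p q; rewrite le_eqVlt => /predU1P[->|pq].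
  rewrite !subrr normr0 powR0 ?mulr0// mulf_neq0 ?invr_eq0 //; lra.
have d0 : 0 < G q - G p.
  by rewrite subr_gt0; apply: (increasing_of_derive pq (fun z _ => dG z)).
set d := G q - G p in d0 *; pose L := d `^ (- (alpha - 1)^-1).
have a1 : alpha - 1 != 0 by rewrite subr_eq0 gt_eqF; lra.
have := momentum_cut g0 dG dH tail (powR_gt0 (- (alpha - 1)^-1) d0) (ltW pq).
rewrite -/d -/L.
have -> : L * d = d `^ ((alpha - 2) / (alpha - 1)).
  rewrite -[X in _ * X]powRr1 ?(ltW d0)// -powRD; last by rewrite (gt_eqF d0) implybT.
  by congr (_ `^ _); field.
have -> : L `^ (2 - alpha) = d `^ ((alpha - 2) / (alpha - 1)).
  by rewrite -powRrM; congr (_ `^ _); field.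
by move=> h; rewrite [leRHS]mulrDl mul1r.
Qed.

(** The mass of [g] is dominated near infinity by its first moment, so [G] and
    [H] both converge there. *)
Lemma momentum_limits g G H (C : R) : (forall s, 0 < g s) ->
  (forall s, is_derive s 1 G (g s)) -> (forall s, is_derive s 1 H (s * g s)) ->
  (forall q, 1 <= q -> H q - H 1 <= C) ->
  exists B HB : R, [/\ forall q, G q < B, G q @[q --> +oo] --> B &
    H q @[q --> +oo] --> HB].
Proof.
move=> g0 dG dH tail.
have Glt s t : s < t -> G s < G t.
  by move=> st; apply: (increasing_of_derive st (fun z _ => dG z)).
have Gle s t : s <= t -> G s <= G t.
  by rewrite le_eqVlt => /predU1P[->//|/Glt/ltW].
have Hle s t : 0 <= s -> s <= t -> H s <= H t.
  move=> s0 st; apply: (nondecreasing_of_derive st (fun z _ => dH z)) => z.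
  by move=> /andP[sz _]; rewrite mulr_ge0 ?(ltW (g0 _))// (le_trans s0).
(* Beyond [1], [g s <= s * g s], so that [H - G] is nondecreasing there. *)
have ubG : ubound (range G) (G 1 + C).
  move=> _ [s _ <-].
  have C0 : 0 <= C by apply: le_trans (tail 1 (lexx _)); rewrite subrr.
  have [s1|s1] := leP s 1; first by have := Gle _ _ s1; lra.
  have dF z : 1 <= z <= s -> is_derive z 1 (fun y => H y - G y) (z * g z - g z).
    move=> _; have := dG z; have := dH z => d1 d2; exact: is_derive_eq.
  have : H 1 - G 1 <= H s - G s.
    apply: (nondecreasing_of_derive (ltW s1) dF) => z /andP[z1 _].
    by rewrite -[X in _ - X]mul1r -mulrBl mulr_ge0 ?subr_ge0// ltW.
  by have := tail s (ltW s1); lra.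
have GB := nondecreasing_cvgr Gle (ex_intro _ _ ubG).
have Gsup s : G s < sup (range G).
  apply: (lt_le_trans (Glt s (s + 1) _)); first by rewrite ltrDl.
  by apply: ub_le_sup; [exists (G 1 + C)|exists (s + 1)].
(* [H] decreases on the negative half-line; only its values beyond [1] matter
   for the limit, and there it is monotone. *)
pose H' s := H (Num.max 1 s).
have H'le s t : s <= t -> H' s <= H' t.
  move=> st; apply: Hle; first by rewrite le_max ler01.
  by rewrite ge_max !le_max lexx st orbT.
have ubH : ubound (range H') (H 1 + C).
  by move=> _ [s _ <-]; have := tail (Num.max 1 s); rewrite le_max lexx /H'; lra.
have HB := nondecreasing_cvgr H'le (ex_intro _ _ ubH).
exists (sup (range G)), (sup (range H')); split => //.
apply: cvg_trans HB; apply: near_eq_cvg.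
near=> s; rewrite /H' max_r //.
Unshelve. all: by end_near. Qed.

End tails.

(** * The profile *)

(** A profile is a maximal solution of [g (Z') * Z'' = 1]: its slope [p] runs
    over the whole real line on the bounded interval [A, B], while [Z] itself
    stays bounded up to the endpoints. *)
Record profile {R : realType} (g : R -> R) (gamma A B : R) (Z p : R -> R) :
    Prop := Profile {
  profile_lt : A < B;
  profile_deriv : forall t, A < t < B -> is_derive t 1 Z (p t);
  profile_deriv2 : forall t, A < t < B -> is_derive t 1 p (g (p t))^-1;
  profile_right : p t @[t --> B^'-] --> +oo;
  profile_left : p t @[t --> A^'+] --> -oo;
  profile_hoelder : hoelder_cc gamma A B Z }.

Section profile_existence.
Context {R : realType}.
Implicit Types (g G H : R -> R).

(** Passing to the limit in a Hoelder estimate with one point fixed. Since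
    [u != B], the power is differentiable, hence continuous, at the limit. *)
Lemma hoelder_limit (F : set_system R) (FF : ProperFilter F) G H
    (K gamma u v B HB : R) :
  G q @[q --> F] --> B -> H q @[q --> F] --> HB ->
  u != B -> (\forall q \near F, `|H q - v| <= K * `|G q - u| `^ gamma) ->
  `|HB - v| <= K * `|B - u| `^ gamma.
Proof.
move=> cG cH uB bnd.
have d0 : 0 < `|B - u| by rewrite normr_gt0 subr_eq0 eq_sym.
have c1 : `|H q - v| @[q --> F] --> `|HB - v|.
  by apply: cvg_norm; apply: cvgB => //; exact: cvg_cst.
have c2 : `|G q - u| @[q --> F] --> `|B - u|.
  by apply: cvg_norm; apply: cvgB => //; exact: cvg_cst.
have c3 : `|G q - u| `^ gamma @[q --> F] --> `|B - u| `^ gamma.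
  apply: (cvg_comp _ (fun x => x `^ gamma) c2).
  exact: (is_derive_continuous (is_derive1_powR gamma d0)).
have c4 : K * `|G q - u| `^ gamma @[q --> F] --> K * `|B - u| `^ gamma.
  by apply: cvgM => //; exact: cvg_cst.
exact: ler_cvg_to c1 c4 bnd.
Qed.

(** With [G' = g] and [H' = s * g s], the slope is [p = G^-1] and the Legendre-type
    formula [Z = H \o G^-1] gives a primitive of it:
    [Z' = p * g p * (1 / g p) = p]. The values of [Z] at [A] and [B] are the
    limits of [H] at infinity. The half-line [s <= 0] is treated through the
    reflected weight [g (- s)], whose primitives are [- G (- s)] and
    [H (- s)]. *)
Lemma profile_exists g (alpha Cp Cm : R) : continuous g ->
  (forall s, 0 < g s) -> 2 < alpha ->
  `|s| `^ alpha * g s @[s --> +oo] --> Cp ->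
  `|s| `^ alpha * g s @[s --> -oo] --> Cm ->
  exists A B Z p, profile g ((alpha - 2) / (alpha - 1)) A B Z p.
Proof.
move=> cg g0 al2 gCp gCm; set gamma := _ / _.
have al0 : 0 <= alpha by lra.
have gam0 : 0 < gamma by rewrite divr_gt0; lra.
have [G dG] := primitive_exists cg.
have [H dH] : exists H, forall x : R, is_derive x 1 H (x * g x).
  by apply: primitive_exists => x; apply: cvgM; [exact: cvg_id|exact: cg].
pose gn s := g (- s); pose Gn s := - G (- s); pose Hn s := H (- s).
have cgn : continuous gn.
  by move=> x; apply: continuous_comp; [exact: opp_continuous|exact: cg].
have gn0 s : 0 < gn s by exact: g0.
have dGn (s : R) : is_derive s 1 Gn (gn s).
  have dGs := dG (- s).
  have dc := is_derive1_comp dGs (is_deriveNid s 1).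
  rewrite /Gn; apply: is_derive_eq; rewrite /gn; ring.
have dHn (s : R) : is_derive s 1 Hn (s * gn s).
  have dHs := dH (- s).
  have dc := is_derive1_comp dHs (is_deriveNid s 1).
  by apply: is_derive_eq; rewrite /gn; ring.
have gnCm : `|s| `^ alpha * gn s @[s --> +oo] --> Cm.
  move/cvgNy_compNP : gCm; apply: cvg_trans; apply: near_eq_cvg.
  by near=> s; rewrite /= normrN.
have [Kp Kp0 gKp] := decay_bound cg g0 al0 gCp.
have [Km Km0 gKm] := decay_bound cgn gn0 al0 gnCm.
pose C := (Kp + Km) / (alpha - 2).
have tailp := tail_bound al2 g0 dH gKp.
have tailn := tail_bound al2 gn0 dHn gKm.
have tail (L p q : R) : 0 < L -> p <= q -> L <= p \/ q <= - L ->
    `|H q - H p| <= C * L `^ (2 - alpha).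
  move=> L0 pq; have X0 := powR_ge0 L (2 - alpha).
  have a2 : 0 < alpha - 2 by lra.
  have Y1 : 0 <= Kp / (alpha - 2) * L `^ (2 - alpha) by rewrite mulr_ge0 // divr_ge0 // ltW.
  have Y2 : 0 <= Km / (alpha - 2) * L `^ (2 - alpha) by rewrite mulr_ge0 // divr_ge0 // ltW.
  rewrite /C mulrDl mulrDl; case=> [Lp|qL].
    by have /andP[h1 h2] := tailp L p q L0 Lp pq; rewrite ger0_norm //; lra.
  have := tailn L (- q) (- p) L0; rewrite /Hn !opprK => /(_ _ _)/andP[||h1 h2].
  - lra.
  - lra.
  - by rewrite distrC ger0_norm //; lra.
have hold p q : `|H q - H p| <= (1 + 2 * C) * `|G q - G p| `^ gamma.
  have Gle x y : x <= y -> G x <= G y.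
    move=> xy; apply: (nondecreasing_of_derive xy (fun z _ => dG z)) => z _.
    exact: ltW.
  have [pq|/ltW qp] := leP p q.
    rewrite [X in (_ * X `^ _)]ger0_norm ?subr_ge0 ?Gle//.
    exact: (momentum_hoelder g0 al2 dG dH tail).
  rewrite distrC (distrC (G q)) [X in (_ * X `^ _)]ger0_norm ?subr_ge0 ?Gle//.
  exact: (momentum_hoelder g0 al2 dG dH tail).
have [B [HB [GB cGB cHB]]] : exists B HB : R, [/\ forall q, G q < B,
    G q @[q --> +oo] --> B & H q @[q --> +oo] --> HB].
  apply: (momentum_limits g0 dG dH) => q q1.
  by have /andP[_ h] := tailp 1 1 q ltr01 (lexx _) q1; exact: h.
have [A [HA [GA cGA cHA]]] : exists A HA : R, [/\ forall q, A < G q,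
    G q @[q --> -oo] --> A & H q @[q --> -oo] --> HA].
  have [A [HA [h1 h2 h3]]] : exists B HB : R, [/\ forall q, Gn q < B,
      Gn q @[q --> +oo] --> B & Hn q @[q --> +oo] --> HB].
    apply: (momentum_limits gn0 dGn dHn) => q q1.
    by have /andP[_ h] := tailn 1 1 q ltr01 (lexx _) q1; exact: h.
  exists (- A), HA; split => [q||].
  - by have := h1 (- q); rewrite /Gn opprK; lra.
  - apply/cvgNy_compNP; apply: cvg_trans (cvgN h2); apply: near_eq_cvg.
    by near=> s; rewrite /Gn /= opprK.
  - exact/cvgNy_compNP.
have Glt s t : s < t -> G s < G t.
  by move=> st; apply: (increasing_of_derive st (fun z _ => dG z)).
have Gmono s t : (G s < G t) = (s < t).
  exact: leW_mono (le_mono Glt) s t.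
have Ginj : injective G.
  by move=> s t st; have [h|h|//] := ltgtP s t; have := Glt _ _ h; rewrite st ltxx.
have Gsurj : forall t, A < t < B -> exists s, G s = t.
  move=> t /andP[At tB].
  have [N [_ HN]] : \forall q \near +oo, t < G q by move: tB; exact: cvgr_gt.
  have [M [_ HM]] : \forall q \near -oo, G q < t by move: At; exact: cvgr_lt.
  pose y := Num.max N M + 1; pose x := Num.min N M - 1.
  have ty : t < G y.
    by apply: HN; rewrite /y (@le_lt_trans _ _ (Num.max N M)) ?le_max ?lexx ?ltrDl.
  have xt : G x < t.
    by apply: HM; rewrite /x (@lt_le_trans _ _ (Num.min N M)) ?ge_min ?lexx ?orbT
      ?gtrBl.
  have xy : x <= y by rewrite ltW// -Gmono (lt_trans xt).
  have cG : {within `[x, y], continuous G}.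
    by apply: continuous_subspaceT => z; exact: is_derive_continuous (dG z).
  have [|s _ <-] := IVT xy cG (v := t); last by exists s.
  by rewrite ge_min le_max (ltW xt) (ltW ty) orbT.
have [p pE] : {p : R -> R & forall t, A < t < B -> G (p t) = t}.
  apply: (@choice _ _ (fun t s => A < t < B -> G s = t)) => t.
  have [/Gsurj[s Gs]|] := boolP (A < t < B); last by exists 0.
  by exists s.
have Gp s : p (G s) = s by apply: Ginj; apply: pE; rewrite GA GB.
have AB : A < B by apply: lt_trans (GA 0) (GB 0).
pose Z t := if t <= A then HA else if B <= t then HB else H (p t).
have ZE t : A < t < B -> Z t = H (p t).
  by move=> /andP[At tB]; rewrite /Z leNgt At leNgt tB.
have ZA : Z A = HA by rewrite /Z lexx.
have ZB : Z B = HB by rewrite /Z lexx leNgt AB.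
have dp (t : R) : A < t < B -> is_derive t 1 p (g (p t))^-1.
  move=> tAB; rewrite -{1}(pE _ tAB).
  apply: is_derive_inverse (dG (p t)) _.
  - by near=> s; exact: Gp.
  - by near=> s; exact: is_derive_continuous (dG s).
  - by rewrite gt_eqF.
exists A, B, Z, p; split => //.
- move=> t tAB; have dpt := dp t tAB; have dHt := dH (p t).
  have dc : is_derive t 1 (H \o p) (p t).
    apply: (is_derive_eq (is_derive1_comp dHt dpt)).
    by rewrite -mulrA mulfV ?mulr1// gt_eqF.
  apply: near_eq_is_derive dc.
  near=> s; rewrite /= ZE //.
  have : s \in `]A, B[ by near: s; apply: near_in_itvoo; rewrite in_itv.
  by rewrite in_itv.
- apply/cvgryPge => M; near=> t.
  have Mt : G M < t by near: t; exact: nbhs_left_gt.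
  have tB : t < B by near: t; exact: nbhs_left_lt.
  by apply/ltW; rewrite -Gmono pE // (lt_trans (GA M)).
- apply/cvgrNyPle => M; near=> t.
  have At : A < t by near: t; exact: nbhs_right_gt.
  have tM : t < G M by near: t; exact: nbhs_right_lt.
  by apply/ltW; rewrite -Gmono pE // At (lt_trans tM).
- have hB t : A < t < B -> `|HB - Z t| <= (1 + 2 * C) * `|B - t| `^ gamma.
    move=> tAB; rewrite ZE //; apply: (hoelder_limit _ cGB cHB).
      by move: tAB => /andP[_ /lt_eqF->].
    by near=> q; rewrite -{2}(pE _ tAB).
  have hA t : A < t < B -> `|HA - Z t| <= (1 + 2 * C) * `|A - t| `^ gamma.
    move=> tAB; rewrite ZE //; apply: (hoelder_limit _ cGA cHA).
      by move: tAB => /andP[/gt_eqF->].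
    by near=> q; rewrite -{2}(pE _ tAB).
  have hAB : `|HB - HA| <= (1 + 2 * C) * `|B - A| `^ gamma.
    apply: (hoelder_limit _ cGB cHB); first by rewrite lt_eqF.
    near=> q; rewrite -(Gp q) -ZE ?GA ?GB // Gp distrC (distrC _ A).
    by apply: hA; rewrite GA GB.
  exists (1 + 2 * C) => s t; rewrite !in_itv /= => /andP[As sB] /andP[At tB].
  have refl x : `|Z x - Z x| <= (1 + 2 * C) * `|x - x| `^ gamma.
    by rewrite !subrr normr0 powR0 ?gt_eqF// mulr0.
  move: As sB; rewrite (le_eqVlt A) (le_eqVlt s) => /predU1P[<- _|As /predU1P[->|sB]].
  + move: At tB; rewrite (le_eqVlt A) (le_eqVlt t) => /predU1P[<- _|At /predU1P[->|tB]] //.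
      by rewrite ZA ZB distrC (distrC A).
    by rewrite ZA hA ?At.
  + move: At tB; rewrite (le_eqVlt A) (le_eqVlt t) => /predU1P[<- _|At /predU1P[->|tB]] //.
      by rewrite ZA ZB.
    by rewrite ZB hB ?At.
  + move: At tB; rewrite (le_eqVlt A) (le_eqVlt t) => /predU1P[<- _|At /predU1P[->|tB]].
    - by rewrite ZA distrC (distrC s) hA ?As.
    - by rewrite ZB distrC (distrC s) hB ?As.
    - rewrite !ZE ?As ?At //.
      have := hold (p t) (p s); rewrite !pE ?As ?At //; exact.
Unshelve. all: by end_near. Qed.

End profile_existence.

(** * Test functions and comparison functions *)

Section parabola.
Context {R : realType}.
Implicit Types (x s r u v : R).

Definition parabola x0 s r (y : R) : R := s * (y - x0) + r * (y - x0) ^+ 2.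

Lemma is_derive_parabola x0 s r (y : R) :
  is_derive y 1 (parabola x0 s r) (s + 2 * r * (y - x0)).
Proof. by rewrite /parabola; apply: is_derive_eq; rewrite /GRing.scale /=; ring. Qed.

Lemma derive1_parabola x0 s r :
  (parabola x0 s r)^`() = (fun y => s + 2 * r * (y - x0)).
Proof. by apply/funext => y; exact: is_derive_derive1 (is_derive_parabola _ _ _ _). Qed.

Lemma is_derive_derive1_parabola x0 s r (y : R) :
  is_derive y 1 (parabola x0 s r)^`() (2 * r).
Proof.
by rewrite derive1_parabola; apply: is_derive_eq; rewrite /GRing.scale /=; ring.
Qed.

Lemma derive2_parabola x0 s r : (parabola x0 s r)^`(2) = cst (2 * r).
Proof.
apply/funext => y; rewrite derive1nS derive1n1.
exact: is_derive_derive1 (is_derive_derive1_parabola _ _ _ _).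
Qed.

Lemma C2_parabola u v x0 s r : C2_cc u v (parabola x0 s r).
Proof.
have cont (F dF : R -> R) : (forall y : R, is_derive y 1 F (dF y)) -> continuous F.
  by move=> dFE y; exact: is_derive_continuous (dFE y).
have cp := cont _ _ (is_derive_parabola x0 s r).
have cp1 := cont _ _ (is_derive_derive1_parabola x0 s r).
have cp2 : continuous (parabola x0 s r)^`(2).
  by rewrite derive2_parabola => y; exact: cst_continuous.
have dp y : derivable (parabola x0 s r) y 1.
  exact: (@ex_derive _ _ _ _ _ _ _ (is_derive_parabola x0 s r y)).
have dp1 y : derivable (parabola x0 s r)^`() y 1.
  exact: (@ex_derive _ _ _ _ _ _ _ (is_derive_derive1_parabola x0 s r y)).
split.
- split; [move=> y _; exact: dp|move=> y _; exact: dp1|].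
  exact: (continuous_subspaceT cp2).
- exact: (continuous_subspaceT cp).
- by exists (parabola x0 s r)^`(); [exact: (continuous_subspaceT cp1)|].
- by exists (parabola x0 s r)^`(2); [exact: (continuous_subspaceT cp2)|].
Qed.

End parabola.

Section viscosity_test.
Context {R : realType} (b : R) (f g V : R -> R) (k' : R).
Context (f_incr : {homo f : x y / x < y}) (g_gt0 : forall s, 0 < g s).
Implicit Types (phi dphi : R -> R) (m x : R).

(** Quadratic test functions suffice: by Taylor, a parabola with a slightly
    smaller second-order coefficient touches [V] at the same point. At an
    endpoint this contradicts the boundary condition, so the contact point is
    interior. Applying [f^-1] turns the inequality between values of [f] into
    one between their arguments. *)
Lemma supersolution_touch phi dphi m (x0 : R) :
  viscosity_supersolution b f g V (f k') ->
  (\forall y \near x0, is_derive (y : R) 1 phi (dphi y)) -> is_derive x0 1 dphi m ->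
  local_min_within `[- b, b] (fun x => V x - phi x) x0 ->
  - b < x0 < b /\ g (dphi x0) * m <= k'.
Proof.
move=> [_ Vin Vbd] dphiE ddphi [x0b min0].
have touch r : 2 * r < m ->
    local_min_within `[- b, b] (fun x => V x - parabola x0 (dphi x0) r x) x0.
  move=> rm; split => //.
  have low := taylor2_lower dphiE ddphi rm.
  apply: filterS2 low min0 => y h1 h2 yb; have := h2 yb.
  by rewrite /parabola subrr expr0n /= !mulr0 addr0; lra.
have x0in : - b < x0 < b.
  have t0 : 2 * ((m - 1) / 2) < m by lra.
  have [nb nNb] := Vbd _ (C2_parabola (- b) b x0 (dphi x0) ((m - 1) / 2)).
  have x0b' : x0 != b.
    apply/eqP => E; apply: nb; rewrite -[X in local_min_within _ _ X]E.
    exact: touch.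
  have x0Nb : - b != x0.
    apply/eqP => E; apply: nNb; rewrite [X in local_min_within _ _ X]E.
    exact: touch.
  move: x0b; rewrite /= in_itv /= => /andP[h1 h2].
  by rewrite !lt_neqAle x0b' x0Nb h1 h2.
split => //; rewrite leNgt; apply/negP => lt0.
have gx := g_gt0 (dphi x0).
pose r := (m + k' / g (dphi x0)) / 4.
have k'm : k' / g (dphi x0) < m by rewrite ltr_pdivrMr // mulrC.
have rm : 2 * r < m by rewrite /r; lra.
have x0in' : x0 \in `]- b, b[ by rewrite in_itv.
have := Vin _ (C2_parabola (- b) b x0 (dphi x0) r) _ x0in' (touch r rm).
rewrite derive2_parabola derive1_parabola subrr mulr0 addr0 subr_ge0 leNgt.
move=> /negP; apply; apply: f_incr.
have kr : k' / g (dphi x0) < 2 * r by rewrite /r; lra.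
by rewrite mulrC -ltr_pdivrMr.
Qed.

Lemma subsolution_touch phi dphi m (x0 : R) :
  viscosity_subsolution b f g V (f k') -> - b < x0 < b ->
  (\forall y \near x0, is_derive (y : R) 1 phi (dphi y)) -> is_derive x0 1 dphi m ->
  local_max_within `[- b, b] (fun x => V x - phi x) x0 ->
  k' <= g (dphi x0) * m.
Proof.
move=> [_ Vin] x0in dphiE ddphi [x0b max0].
rewrite leNgt; apply/negP => lt0.
have gx := g_gt0 (dphi x0).
pose r := (m + k' / g (dphi x0)) / 4.
have k'm : m < k' / g (dphi x0) by rewrite ltr_pdivlMr // mulrC.
have rm : m < 2 * r by rewrite /r; lra.
have touch :
    local_max_within `[- b, b] (fun x => V x - parabola x0 (dphi x0) r x) x0.
  split => //; apply: filterS2 (taylor2_upper dphiE ddphi rm) max0 => y h1 h2 yb.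
  by have := h2 yb; rewrite /parabola subrr expr0n /= !mulr0 addr0; lra.
have x0in' : x0 \in `]- b, b[ by rewrite in_itv.
have := Vin _ (C2_parabola (- b) b x0 (dphi x0) r) _ x0in' touch.
rewrite derive2_parabola derive1_parabola subrr mulr0 addr0 subr_le0 leNgt.
move=> /negP; apply; apply: f_incr.
have kr : 2 * r < k' / g (dphi x0) by rewrite /r; lra.
by rewrite mulrC -ltr_pdivlMr.
Qed.

End viscosity_test.

Section rescaled.
Context {R : realType} (g : R -> R) (gamma A B : R) (Z p : R -> R).
Context (ZP : profile g gamma A B Z p).
Implicit Types (k d x u v : R).

(** [phi = rescaled Z k d] satisfies [g (phi') * phi'' = k]: these are the
    comparison functions, with the speed [k] and the shift [d] as free
    parameters. *)
Definition rescaled k d x : R := Z (k * x + d) / k.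

Lemma rescaled_hoelder k d u v : 0 < k -> A <= k * u + d -> k * v + d <= B ->
  hoelder_cc gamma u v (rescaled k d).
Proof.
move=> k0 Au vB; have [K HK] := profile_hoelder ZP.
exists (K * k `^ gamma / k) => x y; rewrite !in_itv /= => /andP[ux xv] /andP[uy yv].
have inAB z : u <= z -> z <= v -> k * z + d \in `[A, B].
  move=> uz zv; rewrite in_itv /=; apply/andP; split.
    by apply: (le_trans Au); rewrite lerD2r ler_pM2l.
  by apply: le_trans vB; rewrite lerD2r ler_pM2l.
have := HK _ _ (inAB _ ux xv) (inAB _ uy yv).
rewrite /rescaled -mulrBl normrM (gtr0_norm (x := k^-1)) ?invr_gt0 //.
rewrite (_ : k * x + d - (k * y + d) = k * (x - y)); last by ring.
rewrite normrM (gtr0_norm k0) powRM ?normr_ge0 ?(ltW k0) // => h.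
rewrite (_ : K * _ / k * _ = K * (k `^ gamma * `|x - y| `^ gamma) / k).
  by rewrite ler_pM2r ?invr_gt0.
ring.
Qed.

Lemma is_derive_rescaled k d x : k != 0 -> A < k * x + d < B ->
  is_derive x 1 (rescaled k d) (p (k * x + d)).
Proof.
move=> k0 xAB; have dc := is_derive_affine (profile_deriv ZP xAB).
rewrite /rescaled; apply: is_derive_eq.
by rewrite /GRing.scale /=; field.
Qed.

Lemma is_derive2_rescaled k d x : A < k * x + d < B ->
  is_derive x 1 (fun y => p (k * y + d)) (k / g (p (k * x + d))).
Proof. by move=> xAB; exact: is_derive_affine (profile_deriv2 ZP xAB). Qed.

Lemma near_is_derive_rescaled k d x : k != 0 -> A < k * x + d < B ->
  \forall y \near x, is_derive (y : R) 1 (rescaled k d) (p (k * y + d)).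
Proof.
move=> k0 /near_affine_in; apply: filterS => y; exact: is_derive_rescaled.
Qed.

End rescaled.

(** * The speed of a viscosity solution *)

Section comparison.
Context {R : realType} (b : R) (f g : R -> R) (gamma A B : R) (Z p : R -> R).
Context (b_gt0 : 0 < b) (f_incr : {homo f : x y / x < y}).
Context (gamma_gt0 : 0 < gamma) (g_gt0 : forall s, 0 < g s).
Context (ZP : profile g gamma A B Z p).
Context (V : R -> R) (k' : R) (VS : viscosity_solution b f g V (f k')).
Implicit Types (k d x y u v : R).

Local Notation phi := (rescaled Z).

(** For [phi = rescaled Z k d] the quantity [g (phi') * phi''] of the touching
    lemmas is the speed [k] itself, so a contact point compares [k] with the
    speed [k'] of [V]. *)
Lemma rescaled_touch_below k d x : 0 < k -> A < k * x + d < B ->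
  local_min_within `[- b, b] (fun y => V y - phi k d y) x ->
  - b < x < b /\ k <= k'.
Proof.
move=> k0 xAB min0; have [_ _ sup] := VS.
have nd := near_is_derive_rescaled ZP (lt0r_neq0 k0) xAB.
have [xb] := supersolution_touch f_incr g_gt0 sup nd (is_derive2_rescaled ZP xAB) min0.
by rewrite mulrCA mulfV ?mulr1 ?gt_eqF.
Qed.

Lemma rescaled_touch_above k d x : 0 < k -> A < k * x + d < B -> - b < x < b ->
  local_max_within `[- b, b] (fun y => V y - phi k d y) x -> k' <= k.
Proof.
move=> k0 xAB xb max0; have [_ sub _] := VS.
have nd := near_is_derive_rescaled ZP (lt0r_neq0 k0) xAB.
have := subsolution_touch f_incr g_gt0 sub xb nd (is_derive2_rescaled ZP xAB) max0.
by rewrite mulrCA mulfV ?mulr1 ?gt_eqF.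
Qed.

Lemma rescaled_diff_continuous k d u v : 0 < k -> - b <= u -> v <= b ->
  A <= k * u + d -> k * v + d <= B ->
  {within `[u, v], continuous (fun y => V y - phi k d y)}.
Proof.
move=> k0 bu vb Au vB x; apply: continuousB.
  have [cV _ _] := VS.
  apply: (continuous_subspaceW _ cV) => z /=; rewrite !in_itv /= => /andP[uz zv].
  by rewrite (le_trans bu) ?(le_trans zv).
exact: (hoelder_continuous gamma_gt0 (rescaled_hoelder ZP k0 Au vB)).
Qed.

(** If [k' < k], take a speed [kappa] strictly between them: [rescaled Z kappa d]
    is then smooth up to both endpoints, since its slope becomes infinite only
    at the ends of an interval of length [(B - A) / kappa > 2 * b]. It touches
    [V] from below at the minimum of the difference, which forces
    [kappa <= k']. *)
Lemma speed_ge k : 2 * b * k = B - A -> 0 < k -> k <= k'.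
Proof.
move=> kE k0; rewrite leNgt; apply/negP => k'k.
(* [k'] may be negative, but rescaling needs a positive speed. *)
pose m := Num.max k' 0; have mk : m < k by rewrite gt_max k'k k0.
have k'm : k' <= m by rewrite le_max lexx.
have m0 : 0 <= m by rewrite le_max lexx orbT.
pose kappa := (m + k) / 2; have kap0 : 0 < kappa by rewrite /kappa; lra.
pose d := (A + B) / 2.
have inAB x : - b <= x <= b -> A < kappa * x + d < B.
  move=> /andP[bx xb].
  have kb : kappa * b < k * b by rewrite ltr_pM2r // /kappa; lra.
  have h1 : - (kappa * b) <= kappa * x by rewrite -mulrN ler_pM2l.
  have h2 : kappa * x <= kappa * b by rewrite ler_pM2l.
  by apply/andP; split; rewrite /d; lra.
have bb : - b <= b by rewrite ge0_cp // ltW.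
have /andP[h1 _] : A < kappa * - b + d < B by apply: inAB; rewrite lexx.
have /andP[_ h2] : A < kappa * b + d < B by apply: inAB; rewrite bb lexx.
have [x xb xmin] := EVT_min bb
  (rescaled_diff_continuous kap0 (lexx _) (lexx _) (ltW h1) (ltW h2)).
have xAB : A < kappa * x + d < B by apply: inAB; move: xb; rewrite in_itv /=.
have [|_] := rescaled_touch_below kap0 xAB.
  by split => //; rewrite near_withinE; apply: filterE => y; exact: xmin.
by rewrite /kappa; lra.
Qed.

(** If [k < k'], a speed [kappa] strictly between them gives a comparison
    function whose slope blows up already at [- b'] and [b'], inside the
    interval. There [V] is Lipschitz, so the maximum of the difference over
    [[- b', b']] is interior, which forces [k' <= kappa]. *)
Lemma speed_le k : 2 * b * k = B - A -> 0 < k -> loc_lipschitz_oo (- b) b V ->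
  k' <= k.
Proof.
move=> kE k0 lip; rewrite leNgt; apply/negP => kk'.
pose kappa := (k + k') / 2; have kap0 : 0 < kappa by rewrite /kappa; lra.
pose d := (A + B) / 2; pose b' := (B - A) / (2 * kappa).
have AB := profile_lt ZP.
have b'E : kappa * b' = (B - A) / 2 by rewrite /b'; field; rewrite gt_eqF.
have b'0 : 0 < b' by rewrite divr_gt0 ?subr_gt0 // mulr_gt0.
have b'b : b' < b.
  rewrite -(ltr_pM2l kap0) b'E (_ : (B - A) / 2 = k * b); last by rewrite -kE; field.
  by rewrite ltr_pM2r // /kappa; lra.
have EA : kappa * - b' + d = A by rewrite mulrN b'E /d; field.
have EB : kappa * b' + d = B by rewrite b'E /d; field.
have inAB x : - b' < x < b' -> A < kappa * x + d < B.
  by move=> /andP[bx xb]; rewrite -{1}EA -EB !ltrD2r !ltr_pM2l // bx.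
have bb : - b' <= b' by rewrite ge0_cp // ltW.
have cD : {within `[- b', b'], continuous (fun y => V y - phi kappa d y)}.
  by apply: rescaled_diff_continuous; rewrite ?EA ?EB //; lra.
have [x xb xmax] := EVT_max bb cD.
have Nbb' : - b < - b' by rewrite ltrN2.
have [L [_ HL]] := lip (- b') b' Nbb' b'b.
have {HL} lipV y z : y \in `[- b', b'] -> z \in `[- b', b'] ->
    `|V y - V z| <= (L + 1) * `|y - z|.
  by move=> yb zb; have := HL (L + 1); rewrite ltrDl => /(_ ltr01 (y, z)) /=; exact.
have mv y z : y < z -> - b' <= y -> z <= b' ->
    exists2 w, y < w < z & phi kappa d z - phi kappa d y = p (kappa * w + d) * (z - y).
  move=> yz by_ zb.
  have [w||w] := @MVT R (phi kappa d) (fun w => p (kappa * w + d)) y z yz.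
  - rewrite in_itv /= => /andP[yw wz].
    by apply: (is_derive_rescaled ZP (lt0r_neq0 kap0)); apply: inAB; lra.
  - apply: (hoelder_continuous gamma_gt0); apply: (rescaled_hoelder ZP kap0).
      by rewrite -EA lerD2r ler_pM2l.
    by rewrite -EB lerD2r ler_pM2l.
  - by rewrite in_itv /=; exists w.
(* At the maximum point [x]: in the first two cases, [x] is an endpoint and a
   nearby [y] beats it by the mean value theorem. *)
move: (xb); rewrite in_itv /= le_eqVlt (le_eqVlt x) => /andP[].
move=> /predU1P[xE _|b'x /predU1P[xE|xb']].
- have [e /= e0 He] : \forall t \near A^'+, p t < - (L + 1).
    by apply: cvgrNy_lt; exact: (profile_left ZP).
  pose y := Num.min (b' / 2) (- b' + e / (2 * kappa)).
  have y1 : - b' < y.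
    by rewrite lt_min; apply/andP; split; [lra|rewrite ltrDl divr_gt0 // mulr_gt0].
  have y2 : y < b' by rewrite gt_min; apply/orP; left; lra.
  have [w /andP[bw wy] wE] := mv _ _ y1 (lexx _) (ltW y2).
  have pw : p (kappa * w + d) < - (L + 1).
    apply: He; last by rewrite -EA ltrD2r ltr_pM2l.
    have : kappa * w < kappa * (- b' + e / (2 * kappa)).
      rewrite ltr_pM2l //; apply: (lt_le_trans wy).
      by rewrite ge_min lexx orbT.
    have : kappa * - b' < kappa * w by rewrite ltr_pM2l.
    rewrite /ball_ /= -EA mulrDr (_ : kappa * (e / (2 * kappa)) = e / 2); last first.
      by field; rewrite gt_eqF.
    by move=> h1 h2; rewrite ltr0_norm; lra.
  have bb' : - b' \in `[- b', b'] by rewrite in_itv /=; lra.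
  have yb' : y \in `[- b', b'] by rewrite in_itv /=; lra.
  have := xmax y yb'; have := lipV y (- b') yb' bb'; rewrite -xE.
  have yb0 : 0 < y - - b' by lra.
  have : p (kappa * w + d) * (y - - b') < - (L + 1) * (y - - b') by rewrite ltr_pM2r.
  by rewrite (gtr0_norm yb0) ler_norml; lra.
- have [e /= e0 He] : \forall t \near B^'-, L + 1 < p t.
    by apply: cvgry_gt; exact: (profile_right ZP).
  pose y := Num.max (- b' / 2) (b' - e / (2 * kappa)).
  have y1 : y < b'.
    by rewrite gt_max; apply/andP; split; [lra|rewrite gtrBl divr_gt0 // mulr_gt0].
  have y2 : - b' < y by rewrite lt_max; apply/orP; left; lra.
  have [w /andP[yw wb] wE] := mv _ _ y1 (ltW y2) (lexx _).
  have pw : L + 1 < p (kappa * w + d).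
    apply: He; last by rewrite -EB ltrD2r ltr_pM2l.
    have : kappa * (b' - e / (2 * kappa)) < kappa * w.
      rewrite ltr_pM2l //; apply: le_lt_trans yw.
      by rewrite le_max lexx orbT.
    have : kappa * w < kappa * b' by rewrite ltr_pM2l.
    rewrite /ball_ /= -EB mulrBr (_ : kappa * (e / (2 * kappa)) = e / 2); last first.
      by field; rewrite gt_eqF.
    by move=> h1 h2; rewrite gtr0_norm; lra.
  have bb' : b' \in `[- b', b'] by rewrite in_itv /=; lra.
  have yb' : y \in `[- b', b'] by rewrite in_itv /=; lra.
  have := xmax y yb'; have := lipV b' y bb' yb'; rewrite xE.
  have yb0 : 0 < b' - y by lra.
  have : (L + 1) * (b' - y) < p (kappa * w + d) * (b' - y) by rewrite ltr_pM2r.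
  by rewrite (gtr0_norm yb0) ler_norml; lra.
- have : k' <= kappa; last by rewrite /kappa; lra.
  apply: (@rescaled_touch_above kappa d x kap0); first by apply: inAB; rewrite b'x.
    by lra.
  split; first by rewrite /= in_itv /=; lra.
  have : x \in `]- b', b'[ by rewrite in_itv /= b'x.
  move=> /near_in_itvoo; apply: filterS => y; rewrite in_itv /= => /andP[y1 y2] _.
  by apply: xmax; rewrite in_itv /= !ltW.
Qed.

End comparison.

(** * Uniqueness up to a constant *)

Section uniqueness.
Context {R : realType} (b : R) (f g : R -> R) (gamma A B : R) (Z p : R -> R).
Context (b_gt0 : 0 < b) (f_incr : {homo f : x y / x < y}).
Context (gamma_gt0 : 0 < gamma) (g_gt0 : forall s, 0 < g s).
Context (ZP : profile g gamma A B Z p).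
Context (V : R -> R) (k : R) (VS : viscosity_solution b f g V (f k)).
Context (k_gt0 : 0 < k).
Implicit Types (d x y u v : R).

Local Notation phi := (rescaled Z).
Local Notation D d := (fun y => V y - phi k d y).

Lemma rescaled_cvg_speed d y : A < k * y + d < B ->
  V y - phi kappa d y @[kappa --> k] --> D d y.
Proof.
move=> yAB; apply: cvgB; first exact: cvg_cst.
apply: cvgM; last by apply: cvgV; [exact: lt0r_neq0|exact: cvg_id].
apply: (@cvg_comp _ _ _ (fun kappa => kappa * y + d) Z).
  by apply: cvgD; [apply: cvgM; [exact: cvg_id|exact: cvg_cst]|exact: cvg_cst].
exact: (is_derive_continuous (profile_deriv ZP yAB)).
Qed.

Lemma affine_cvg_speed d y : kappa * y + d @[kappa --> k] --> k * y + d.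
Proof. by apply: cvgD; [apply: cvgM; [exact: cvg_id|exact: cvg_cst]|exact: cvg_cst]. Qed.

Lemma rescaled_lt_speed d x y : A < k * x + d < B -> A < k * y + d < B ->
  D d x < D d y ->
  \forall kappa \near k, V x - phi kappa d x < V y - phi kappa d y.
Proof.
move=> xAB yAB xy.
have c : (V y - phi kappa d y) - (V x - phi kappa d x) @[kappa --> k]
    --> D d y - D d x.
  by apply: cvgB; exact: rescaled_cvg_speed.
have yx0 : 0 < D d y - D d x by rewrite subr_gt0.
by apply: filterS (cvgr_gt _ c _ yx0) => kappa; rewrite subr_gt0.
Qed.

Lemma affine_between d u x v : u <= x -> x <= v -> A < k * u + d ->
  k * v + d < B -> A < k * x + d < B.
Proof.
move=> ux xv uA vB; apply/andP; split.
  by apply: (lt_le_trans uA); rewrite lerD2r ler_pM2l.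
by apply: le_lt_trans vB; rewrite lerD2r ler_pM2l.
Qed.

(** With equal speeds a contact point gives no contradiction, so the speed of
    the comparison function is increased slightly. A strict interior minimum
    survives this perturbation, and pointwise convergence at the three points
    [u], [x], [v] is enough. *)
Lemma no_interior_min d u x v : - b <= u -> u < x -> x < v -> v <= b ->
  A < k * u + d -> k * v + d < B -> D d x < D d u -> D d v <= D d x.
Proof.
move=> bu ux xv vb uA vB xu; rewrite leNgt; apply/negP => xv'.
have uv := lt_trans ux xv.
have uAB := affine_between (lexx u) (ltW uv) uA vB.
have xAB := affine_between (ltW ux) (ltW xv) uA vB.
have vAB := affine_between (ltW uv) (lexx v) uA vB.
have nu := rescaled_lt_speed xAB uAB xu.
have nv := rescaled_lt_speed xAB vAB xv'.
have nA : \forall kappa \near k, A < kappa * u + d.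
  exact: (cvgr_gt _ (@affine_cvg_speed d u) _ uA).
have nB : \forall kappa \near k, kappa * v + d < B.
  exact: (cvgr_lt _ (@affine_cvg_speed d v) _ vB).
near k^'+ => kappa.
have kk : k < kappa by near: kappa; exact: nbhs_right_gt.
have kap0 := lt_trans k_gt0 kk.
have hu : V x - phi kappa d x < V u - phi kappa d u.
  by near: kappa; exact: cvg_within nu.
have hv : V x - phi kappa d x < V v - phi kappa d v by near: kappa; exact: cvg_within nv.
have hA : A < kappa * u + d by near: kappa; exact: cvg_within nA.
have hB : kappa * v + d < B by near: kappa; exact: cvg_within nB.
have [c cuv cmin] := EVT_min (ltW uv)
  (rescaled_diff_continuous gamma_gt0 ZP VS kap0 bu vb (ltW hA) (ltW hB)).
have cx : V c - phi kappa d c <= V x - phi kappa d x.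
  by apply: cmin; rewrite in_itv /= (ltW ux) (ltW xv).
have cu : u < c.
  move: cuv; rewrite in_itv /= le_eqVlt => /andP[/predU1P[uc|//] _].
  by move: cx; rewrite -uc leNgt hu.
have cv : c < v.
  move: cuv; rewrite in_itv /= (le_eqVlt c) => /andP[_ /predU1P[uc|//]].
  by move: cx; rewrite uc leNgt hv.
have [||_] := rescaled_touch_below f_incr g_gt0 ZP VS (k := kappa) (d := d) (x := c) kap0.
- apply/andP; split.
    by apply: (lt_trans hA); rewrite ltrD2r ltr_pM2l.
  by apply: lt_trans hB; rewrite ltrD2r ltr_pM2l.
- split; first by rewrite /= in_itv /= (le_trans bu) ?(ltW cu) // (le_trans (ltW cv)).
  have : c \in `]u, v[ by rewrite in_itv /= cu.
  move=> /near_in_itvoo; apply: filterS => y; rewrite in_itv /= => /andP[y1 y2] _.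
  by apply: cmin; rewrite in_itv /= !ltW.
- by rewrite leNgt kk.
Unshelve. all: by end_near. Qed.

(** As for [no_interior_min], decreasing the speed. *)
Lemma no_interior_max d u x v : - b <= u -> u < x -> x < v -> v <= b ->
  A < k * u + d -> k * v + d < B -> D d u < D d x -> D d x <= D d v.
Proof.
move=> bu ux xv vb uA vB xu; rewrite leNgt; apply/negP => xv'.
have uv := lt_trans ux xv.
have uAB := affine_between (lexx u) (ltW uv) uA vB.
have xAB := affine_between (ltW ux) (ltW xv) uA vB.
have vAB := affine_between (ltW uv) (lexx v) uA vB.
have nu := rescaled_lt_speed uAB xAB xu.
have nv := rescaled_lt_speed vAB xAB xv'.
have nA : \forall kappa \near k, A < kappa * u + d.
  exact: (cvgr_gt _ (@affine_cvg_speed d u) _ uA).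
have nB : \forall kappa \near k, kappa * v + d < B.
  exact: (cvgr_lt _ (@affine_cvg_speed d v) _ vB).
near k^'- => kappa.
have kk : kappa < k by near: kappa; exact: nbhs_left_lt.
have kap0 : 0 < kappa by near: kappa; exact: nbhs_left_gt.
have hu : V u - phi kappa d u < V x - phi kappa d x.
  by near: kappa; exact: cvg_within nu.
have hv : V v - phi kappa d v < V x - phi kappa d x by near: kappa; exact: cvg_within nv.
have hA : A < kappa * u + d by near: kappa; exact: cvg_within nA.
have hB : kappa * v + d < B by near: kappa; exact: cvg_within nB.
have [c cuv cmax] := EVT_max (ltW uv)
  (rescaled_diff_continuous gamma_gt0 ZP VS kap0 bu vb (ltW hA) (ltW hB)).
have cx : V x - phi kappa d x <= V c - phi kappa d c.
  by apply: cmax; rewrite in_itv /= (ltW ux) (ltW xv).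
have cu : u < c.
  move: cuv; rewrite in_itv /= le_eqVlt => /andP[/predU1P[uc|//] _].
  by move: cx; rewrite -uc leNgt hu.
have cv : c < v.
  move: cuv; rewrite in_itv /= (le_eqVlt c) => /andP[_ /predU1P[uc|//]].
  by move: cx; rewrite uc leNgt hv.
suff : k <= kappa by rewrite leNgt kk.
apply: (rescaled_touch_above f_incr g_gt0 ZP VS (d := d) (x := c) kap0).
- apply/andP; split.
    by apply: (lt_trans hA); rewrite ltrD2r ltr_pM2l.
  by apply: lt_trans hB; rewrite ltrD2r ltr_pM2l.
- by rewrite (le_lt_trans bu) // (lt_le_trans cv).
- split; first by rewrite /= in_itv /= (le_trans bu) ?(ltW cu) // (le_trans (ltW cv)).
  have : c \in `]u, v[ by rewrite in_itv /= cu.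
  move=> /near_in_itvoo; apply: filterS => y; rewrite in_itv /= => /andP[y1 y2] _.
  by apply: cmax; rewrite in_itv /= !ltW.
Unshelve. all: by end_near. Qed.

(** When [phi k d] is smooth at [- b], the boundary condition prevents
    [V - phi k d] from having a local minimum there; but a strict increase
    from [u] to [v], together with the absence of interior extrema, would make
    [- b] one. *)
Lemma diff_nonincreasing d u v : A < k * - b + d -> - b <= u -> u < v -> v <= b ->
  k * v + d < B -> D d v <= D d u.
Proof.
move=> bA bu uv vb vB; rewrite leNgt; apply/negP => Duv.
have bv : - b < v := le_lt_trans bu uv.
have nbu : D d (- b) <= D d u.
  move: bu; rewrite le_eqVlt => /predU1P[->//|bu].
  rewrite leNgt; apply/negP => ub.
  by have := no_interior_min (lexx _) bu uv vb bA vB ub; rewrite leNgt Duv.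
have bAB : A < k * - b + d < B by apply: (affine_between (lexx _) (ltW bv)).
have [|] := rescaled_touch_below f_incr g_gt0 ZP VS k_gt0 bAB; last by rewrite ltxx.
split; first by rewrite /= in_itv /= lexx (le_trans bu) // (le_trans (ltW uv)).
have : - b \in `]- b - 1, v[ by rewrite in_itv /= bv gtrBl ltr01.
move=> /near_in_itvoo; apply: filterS => y; rewrite in_itv /= => /andP[_ yv].
rewrite in_itv /= => /andP[+ _]; rewrite le_eqVlt => /predU1P[<-//|yb].
rewrite leNgt; apply/negP => Dy.
have := no_interior_min (lexx _) yb yv vb bA vB Dy.
by rewrite leNgt (lt_le_trans Dy) // (le_trans nbu) // ltW.
Qed.

Lemma diff_nondecreasing d u v : k * b + d < B -> - b <= u -> u < v -> v <= b ->
  A < k * u + d -> D d u <= D d v.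
Proof.
move=> bB bu uv vb uA; rewrite leNgt; apply/negP => Duv.
have ub : u < b := lt_le_trans uv vb.
have nbv : D d b <= D d v.
  move: vb; rewrite le_eqVlt => /predU1P[->//|vb].
  have := no_interior_max bu uv vb (lexx _) uA bB.
  have [Duv' _|+ _] := ltP (D d v) (D d b); last by [].
  by have := no_interior_min bu uv vb (lexx _) uA bB Duv; rewrite leNgt Duv'.
have bAB : A < k * b + d < B by apply: (affine_between (ltW ub) (lexx _)).
have [|/andP[_]] := rescaled_touch_below f_incr g_gt0 ZP VS k_gt0 bAB;
  last by rewrite ltxx.
split; first by rewrite /= in_itv /= lexx (le_trans bu) // ltW.
have : b \in `]u, b + 1[ by rewrite in_itv /= ub ltrDl ltr01.
move=> /near_in_itvoo; apply: filterS => y; rewrite in_itv /= => /andP[uy _].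
rewrite in_itv /= => /andP[_]; rewrite le_eqVlt => /predU1P[->//|yb].
rewrite leNgt; apply/negP => Dy.
have Dyu : D d y < D d u by rewrite (lt_le_trans Dy) // (le_trans nbv) // ltW.
by have := no_interior_min bu uy yb (lexx _) uA bB Dyu; rewrite leNgt Dy.
Qed.

(** Moving the shift slightly above [d] makes the comparison function smooth at
    [- b], and the difference nonincreasing; moving it below [d] makes the
    difference nondecreasing. In the limit the difference is both. *)
Lemma diff_constant d : k * - b + d = A -> k * b + d = B ->
  exists a, {in `[- b, b], forall x, V x = phi k d x + a}.
Proof.
move=> EA EB.
have inAB x : - b < x < b -> A < k * x + d < B.
  by move=> /andP[bx xb]; rewrite -{1}EA -EB !ltrD2r !ltr_pM2l // bx.
have cvg_shift x : - b < x < b -> D e x @[e --> d] --> D d x.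
  move=> xb; apply: cvgB; first exact: cvg_cst.
  apply: cvgM; last exact: cvg_cst.
  apply: (@cvg_comp _ _ _ (fun e => k * x + e) Z).
    by apply: cvgD; [exact: cvg_cst|exact: cvg_id].
  exact: (is_derive_continuous (profile_deriv ZP (inAB x xb))).
have cvg_affine x : k * x + e @[e --> d] --> k * x + d.
  by apply: cvgD; [exact: cvg_cst|exact: cvg_id].
have Dconst u v : - b < u -> u < v -> v < b -> D d u = D d v.
  move=> bu uv vb.
  have ub : - b < u < b by rewrite bu (lt_trans uv).
  have vb' : - b < v < b by rewrite vb (lt_trans bu).
  have nA : \forall e \near d, A < k * u + e.
    by have /andP[h _] := inAB u ub; exact: (cvgr_gt _ (cvg_affine u) _ h).
  have nB : \forall e \near d, k * v + e < B.
    by have /andP[_ h] := inAB v vb'; exact: (cvgr_lt _ (cvg_affine v) _ h).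
  apply/eqP; rewrite eq_le; apply/andP; split.
    apply: (ler_cvg_to (cvg_at_left_filter (cvg_shift u ub))
      (cvg_at_left_filter (cvg_shift v vb'))).
    near=> e; apply: diff_nondecreasing (ltW bu) uv (ltW vb) _.
      by rewrite -[ltRHS]EB ltrD2l; near: e; exact: nbhs_left_lt.
    by near: e; exact: cvg_within nA.
  apply: (ler_cvg_to (cvg_at_right_filter (cvg_shift v vb'))
    (cvg_at_right_filter (cvg_shift u ub))).
  near=> e; apply: diff_nonincreasing (ltW bu) uv (ltW vb) _.
    by rewrite -[ltLHS]EA ltrD2l; near: e; exact: nbhs_right_gt.
  by near: e; exact: cvg_within nB.
have b0 : - b < 0 < b by rewrite oppr_lt0 b_gt0.
have D0 x : - b < x < b -> D d x = D d 0.
  move=> /andP[bx xb]; move: b0 => /andP[? ?].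
  have [x0|x0|->//] := ltgtP x 0; [exact: Dconst|exact/esym/Dconst].
exists (D d 0) => x; rewrite in_itv /= => /andP[bx xb].
suff -> : D d 0 = D d x by rewrite addrC subrK.
have Nbb : - b < b by move: b0 => /andP[/lt_trans]; apply.
have : {within `[- b, b], continuous (D d)}.
  by apply: (rescaled_diff_continuous gamma_gt0 ZP VS); rewrite ?EA ?EB.
move=> /(continuous_within_itvP _ Nbb)[_ cl cr].
move: bx xb; rewrite le_eqVlt (le_eqVlt x) => /predU1P[<- _|bx /predU1P[->|xb]].
- have c0 : D d y @[y --> (- b)^'+] --> D d 0.
    apply: cvg_near_cst; near=> y.
    by rewrite D0 //; apply/andP; split; near: y;
      [exact: nbhs_right_gt|exact: nbhs_right_lt].
  exact: (cvg_unique _ c0 cl).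
- have c0 : D d y @[y --> b^'-] --> D d 0.
    apply: cvg_near_cst; near=> y.
    by rewrite D0 //; apply/andP; split; near: y;
      [exact: nbhs_left_gt|exact: nbhs_left_lt].
  exact: (cvg_unique _ c0 cr).
- by rewrite D0 // bx.
Unshelve. all: by end_near. Qed.

End uniqueness.

(** * Existence, regularity and the theorem *)

Section profile_solution.
Context {R : realType} (b : R) (f g : R -> R) (gamma A B : R) (Z p : R -> R).
Context (b_gt0 : 0 < b) (gamma_gt0 : 0 < gamma).
Context (g_cont : continuous g) (g_gt0 : forall s, 0 < g s).
Context (ZP : profile g gamma A B Z p) (k d : R) (k_gt0 : 0 < k).
Context (EA : k * - b + d = A) (EB : k * b + d = B).

Local Notation W := (rescaled Z k d).

Let inAB x : - b < x < b -> A < k * x + d < B.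
Proof. by move=> /andP[bx xb]; rewrite -{1}EA -EB !ltrD2r !ltr_pM2l // bx. Qed.

Let derive1W x : - b < x < b -> W^`() x = p (k * x + d).
Proof.
move=> /inAB xAB.
exact: is_derive_derive1 (is_derive_rescaled ZP (lt0r_neq0 k_gt0) xAB).
Qed.

Let near_in x : - b < x < b -> \forall y \near x, - b < y < b.
Proof.
move=> xb; have xin : x \in `]- b, b[ by rewrite in_itv.
by apply: filterS (near_in_itvoo xin) => y; rewrite in_itv.
Qed.

Let is_derive2W x : - b < x < b ->
  is_derive x 1 W^`() (k / g (p (k * x + d))).
Proof.
move=> xb; apply: near_eq_is_derive (is_derive2_rescaled ZP (inAB xb)).
by apply: filterS (near_in xb) => y /derive1W.
Qed.

Let derive2W x : - b < x < b -> W^`(2) x = k / g (p (k * x + d)).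
Proof.
by move=> xb; rewrite derive1nS derive1n1; exact: is_derive_derive1 (is_derive2W xb).
Qed.

Lemma rescaled_profile_hoelder : hoelder_cc gamma (- b) b W.
Proof. by apply: (rescaled_hoelder ZP k_gt0); rewrite ?EA ?EB. Qed.

Lemma rescaled_profile_strictly_convex : strictly_convex_cc (- b) b W.
Proof.
have cW := hoelder_continuous gamma_gt0 rescaled_profile_hoelder.
have dW x : - b < x < b -> is_derive x 1 W (p (k * x + d)).
  by move=> /inAB; exact: (is_derive_rescaled ZP (lt0r_neq0 k_gt0)).
apply: (strictly_convex_of_derive cW dW) => x y bx xy yb.
have dE z : x <= z <= y ->
    is_derive z 1 (fun x => p (k * x + d)) (k / g (p (k * z + d))).
  move=> /andP[xz zy]; apply: (is_derive2_rescaled ZP); apply: inAB.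
  by rewrite (lt_le_trans bx) // (le_lt_trans zy).
by apply: (increasing_of_derive xy dE) => z _; rewrite divr_gt0.
Qed.

Lemma rescaled_profile_classical : classical_solution b f g W (f k).
Proof.
have C2 : C2_oo (- b) b W.
  split.
  - move=> x; rewrite in_itv /= => /inAB xAB.
    exact: (@ex_derive _ _ _ _ _ _ _ (is_derive_rescaled ZP (lt0r_neq0 k_gt0) xAB)).
  - move=> x; rewrite in_itv /= => xb.
    exact: (@ex_derive _ _ _ _ _ _ _ (is_derive2W xb)).
  - apply: continuous_subspace_itv => x xin.
    have xb : - b < x < b by move: xin; rewrite in_itv.
    have cp := is_derive_continuous (is_derive2_rescaled ZP (inAB xb)).
    have cW : k / g (p (k * y + d)) @[y --> x] --> k / g (p (k * x + d)).
      apply: cvgM; first exact: cvg_cst.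
      apply: cvgV; first by rewrite gt_eqF.
      by apply: (@cvg_comp _ _ _ (fun y => p (k * y + d)) g); [exact: cp|exact: g_cont].
    rewrite /continuous_at derive2W //; apply: cvg_trans cW; apply: near_eq_cvg.
    by apply: filterS (near_in xb) => y /derive2W ->.
have Nbb : - b < b by rewrite gtrN.
split => //.
- exact: (hoelder_continuous gamma_gt0 rescaled_profile_hoelder).
- move=> x xin; have xb : - b < x < b by move: xin; rewrite in_itv.
  rewrite derive1W // derive2W //; congr f.
  by rewrite mulrCA mulfV ?mulr1 // gt_eqF.
- have := cvg_comp _ _ (affine_at_left k_gt0 EB) (profile_right ZP).
  apply: cvg_trans; apply: near_eq_cvg; near=> x.
  by rewrite /= derive1W //; apply/andP; split; near: x;
    [exact: nbhs_left_gt|exact: nbhs_left_lt].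
- have := cvg_comp _ _ (affine_at_right k_gt0 EA) (profile_left ZP).
  apply: cvg_trans; apply: near_eq_cvg; near=> x.
  by rewrite /= derive1W //; apply/andP; split; near: x;
    [exact: nbhs_right_gt|exact: nbhs_right_lt].
Unshelve. all: by end_near. Qed.

End profile_solution.

Unset Implicit Arguments.

Theorem theorem1p3 (R : realType) (b : R) (f g : R -> R) (alpha Cp Cm : R)
  (b_gt0 : 0 < b)
  (f_cont : continuous f)
  (f_incr : {homo f : x y / x < y})
  (f0 : f 0 = 0)
  (f_pinfty : f s @[s --> +oo] --> +oo)
  (f_ninfty : f s @[s --> -oo] --> -oo)
  (g_cont : continuous g)
  (g_gt0 : forall s, 0 < g s)
  (alpha_gt2 : 2 < alpha)
  (Cp_gt0 : 0 < Cp)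
  (Cm_gt0 : 0 < Cm)
  (g_pinfty : `|s| `^ alpha * g s @[s --> +oo] --> Cp)
  (g_ninfty : `|s| `^ alpha * g s @[s --> -oo] --> Cm) :
  exists (W : R -> R) (c : R),
    [/\ 0 < c,
        classical_solution b f g W c,
        forall (W' : R -> R) (c' : R),
          loc_lipschitz_oo (- b) b W' ->
          viscosity_solution b f g W' c' ->
          c' = c /\ exists a : R, {in `[- b, b], forall x, W' x = W x + a},
        strictly_convex_cc (- b) b W &
        hoelder_cc ((alpha - 2) / (alpha - 1)) (- b) b W].
Proof.
have [A [B [Z [p ZP]]]] := profile_exists g_cont g_gt0 alpha_gt2 g_pinfty g_ninfty.
have AB := profile_lt ZP.
have gam0 : 0 < (alpha - 2) / (alpha - 1) by rewrite divr_gt0; lra.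
pose k := (B - A) / (2 * b); pose d := (A + B) / 2.
have k0 : 0 < k by rewrite divr_gt0 ?subr_gt0 // mulr_gt0.
have kE : 2 * b * k = B - A by rewrite /k mulrC divfK // gt_eqF // mulr_gt0.
have EA : k * - b + d = A by rewrite /k /d; field; rewrite gt_eqF.
have EB : k * b + d = B by rewrite /k /d; field; rewrite gt_eqF.
exists (rescaled Z k d), (f k); split.
- by rewrite -f0; exact: f_incr.
- exact: (rescaled_profile_classical _ b_gt0 gam0 g_cont g_gt0 ZP k0 EA EB).
- move=> V c' lip; have [k' <- VS] :=
    continuous_unbounded_surj f_cont f_pinfty f_ninfty c'.
  have k'k : k' = k.
    apply/eqP; rewrite eq_le (speed_le b_gt0 f_incr gam0 g_gt0 ZP VS kE k0 lip).
    exact: (speed_ge b_gt0 f_incr gam0 g_gt0 ZP VS kE k0).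
  rewrite k'k in VS *; split => //.
  exact: (diff_constant b_gt0 f_incr gam0 g_gt0 ZP VS k0 EA EB).
- exact: (rescaled_profile_strictly_convex gam0 g_gt0 ZP k0 EA EB).
- exact: (rescaled_profile_hoelder ZP k0 EA EB).
Qed.
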